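(* Let $\mathcal{D}$ be a finite set with $N=|\mathcal{D}|$, let $\mathbf{R}=\{\mathbf{r}_1,\dots,\mathbf{r}_\ell\}\subseteq[0,1]$ be finite, and let $\mathbf{q}\in\mathbf{R}^{\mathcal{D}}$ with $\sum_x\mathbf{q}_x\le1$. Let $\phi$ be a profile with distinct non-zero frequencies $\mathbf{m}_1,\dots,\mathbf{m}_k$ having multiplicities $\phi_1,\dots,\phi_k$, with $\sum_{j\ge1}\phi_j\le N$; set $\mathbf{m}_0=0$, $\phi_0=N-\sum_{j\ge1}\phi_j$. Let $\mathbf{A}$ be the $\mathcal{D}\times\mathcal{D}$ matrix $\mathbf{A}_{x,y}=\mathbf{q}_x^{\mathbf{f}_y}$. Then $$\log\mathrm{perm}(\mathbf{A})\ge\max_{\mathbf{S}\in\mathbf{Z}^{\mathbf{q},\phi}_{\mathbf{R}}}\mathbf{h}(\mathbf{S}).$$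
   Context: Here $\mathbf{f}\in\mathbb{Z}_{\ge0}^{\mathcal{D}}$ is a frequency vector with, for each $j\in[0,k]$, exactly $\phi_j$ elements $y$ having $\mathbf{f}_y=\mathbf{m}_j$ (the permanent does not depend on the choice). $\ell^{\mathbf{q}}_i=|\{y\in\mathcal{D}:\mathbf{q}_y=\mathbf{r}_i\}|$. $\mathbf{Z}^{\mathbf{q},\phi}_{\mathbf{R}}$ is the set of $\mathbf{S}\in\mathbb{R}_{\ge0}^{\ell\times(k+1)}$ (columns indexed by $[0,k]$) with $\sum_{j=0}^k\mathbf{S}_{i,j}=\ell^{\mathbf{q}}_i$ for all $i$ and $\sum_{i=1}^\ell\mathbf{S}_{i,j}=\phi_j$ for all $j\in[0,k]$. For $\mathbf{S}\in\mathbb{R}_{\ge0}^{\ell\times(k+1)}$, $\mathbf{h}(\mathbf{S})=\sum_{i,j}\mathbf{S}_{i,j}\log\frac{\mathbf{r}_i^{\mathbf{m}_j}}{\mathbf{S}_{i,j}}+\sum_i\big(\sum_j\mathbf{S}_{i,j}\big)\log\big(\sum_j\mathbf{S}_{i,j}\big)+\sum_{j=0}^k\phi_j\log\phi_j-\sum_{j=0}^k\phi_j$ (conventions $0\log0=0$, $0^0=1$, $\log0=-\infty$). $\mathrm{perm}$ is the permanent. *)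

(* Defs.v *)
From HB Require Import structures.
From mathcomp Require Import all_boot all_order all_algebra all_fingroup.
From mathcomp Require Import all_classical all_reals all_analysis.

Set Implicit Arguments.
Unset Strict Implicit.
Unset Printing Implicit Defensive.

Import Order.TTheory GRing.Theory Num.Theory.

Local Open Scope classical_set_scope.
Local Open Scope ring_scope.

Definition permanent {R : pzSemiRingType} {D : finType} (A : D -> D -> R) : R :=
  \sum_(s : {perm D}) \prod_(x : D) A x (s x).

(* Extends a family indexed by [1, k] (here 'I_k) to [0, k] (here 'I_k.+1);
   the index j >= 1 of the extension corresponds to j.-1 in 'I_k. *)
Definition with0 {T : Type} {k : nat} (a0 : T) (a : 'I_k -> T)
    (j : 'I_k.+1) : T :=
  if unlift ord0 j is Some i then a i else a0.

Definition freqs {k : nat} (m : 'I_k -> nat) : 'I_k.+1 -> nat := with0 0%N m.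

Definition mults {k : nat} (N : nat) (phi : 'I_k -> nat) : 'I_k.+1 -> nat :=
  with0 (N - \sum_(j < k) phi j)%N phi.

Definition level {R : realType} {D : finType} {l : nat}
    (r : 'I_l -> R) (q : D -> R) (i : 'I_l) : nat :=
  #|[set y : D | q y == r i]%SET|.

Definition Zset {R : realType} {l k : nat}
    (lev : 'I_l -> nat) (phi : 'I_k.+1 -> nat) : set 'M[R]_(l, k.+1) :=
  [set S | [/\ forall i j, 0 <= S i j,
               forall i, \sum_j S i j = (lev i)%:R
             & forall j, \sum_i S i j = (phi j)%:R]].

(* x log y for x, y >= 0, with log 0 = -oo.  Since 0 * -oo = 0 in \bar R,
   xlog 0 y = 0 for every y. *)
Definition xlog {R : realType} (x y : R) : \bar R := (x%:E * lne y%:E)%E.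

(* No summand can be +oo, so the sums in \bar R are unambiguous.  When
   S i j = 0, the quotient is 0 (x / 0 = 0) and the term vanishes by xlog. *)
Definition h {R : realType} {l k : nat}
    (r : 'I_l -> R) (m phi : 'I_k.+1 -> nat) (S : 'M[R]_(l, k.+1)) : \bar R :=
  (\sum_(i < l) \sum_(j < k.+1) xlog (S i j) (r i ^+ m j / S i j)
   + \sum_(i < l) xlog (\sum_(j < k.+1) S i j) (\sum_(j < k.+1) S i j)
   + \sum_(j < k.+1) xlog (phi j)%:R (phi j)%:R
   - \sum_(j < k.+1) (phi j)%:R%:E)%E.

Definition is_max {R : realType} (A : set (\bar R)) (v : \bar R) : Prop :=
  A v /\ ubound A v.

(* Main.v *)
Require Import Defs.
From HB Require Import structures.
From mathcomp Require Import all_boot all_order all_algebra all_fingroup.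
From mathcomp Require Import all_classical all_reals all_analysis.
From mathcomp Require Import ring lra.

Set Implicit Arguments.
Unset Strict Implicit.
Unset Printing Implicit Defensive.

Import Order.TTheory GRing.Theory Num.Theory.
Import numFieldNormedType.Exports.

Local Open Scope classical_set_scope.
Local Open Scope ring_scope.

(* Spreading the mass of S uniformly over the blocks of constant entries gives
   the doubly stochastic matrix Q x y = S i j / (l_i phi_j), and
   h S = sum_(x, y) Q x y log (A x y / Q x y) - N.  By the weighted AM-GM
   inequality the capacity of the polynomial prod_x sum_y z_y A x y, i.e. the
   infimum over z > 0 of its quotient by prod_y z_y, is at least
   exp (sum Q log (A / Q)), so it suffices that perm A >= e^-N capacity.  As in
   Gurvits' proof, differentiating in one variable at 0 loses at most a factor
   e; instead of real stability this uses the log-concavity provided by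
   Alexandrov's inequality for mixed permanents.  The latter is proved by
   induction: Laplace expansion along one column turns the inequality in
   dimension n - 1 into a Bochner-type inequality a <= a^2 for the eigenvalues
   a of a reversible Markov kernel, which therefore has no eigenvalue in
   (0, 1). *)

(** * Spectral gap of a reversible kernel *)

Section ReversibleKernel.
Variables (R : realType) (T : finType) (U : {set T}) (K : T -> T -> R).
Hypothesis K_sym : forall i j, K i j = K j i.
Hypothesis K_ge0 : forall i j, 0 <= K i j.
Hypothesis K_gt0 : forall i j, i \in U -> j \in U -> i != j -> 0 < K i j.
Let g i := \sum_(j in U) K i j.
Hypothesis g_gt0 : forall i, i \in U -> 0 < g i.
Let Ku (u : T -> R) i := \sum_(j in U) K i j * u j.
Let E u := \sum_(i in U) u i * Ku u i.
Let N u := \sum_(i in U) g i * u i ^+ 2.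

(** With [a = 1] this puts the spectrum above -1; with [a = -1] it is the Dirichlet form used for
    the gap. *)
Let sum_sqr_pm (a : R) u : a ^+ 2 = 1 ->
  \sum_(i in U) \sum_(j in U) K i j * (u i + a * u j) ^+ 2
  = 2 * (N u + a * E u).
Proof.
move=> a1.
have -> : 2 * (N u + a * E u) = N u + N u + 2 * a * E u by ring.
have {2}-> : N u = \sum_(i in U) \sum_(j in U) K i j * u j ^+ 2.
  rewrite exchange_big /=; apply: eq_bigr => i _.
  by rewrite /g mulr_suml; apply: eq_bigr => j _; rewrite K_sym.
rewrite /N /E mulr_sumr -!big_split /=; apply: eq_bigr => i _.
rewrite /g /Ku mulr_suml mulrA mulr_sumr -!big_split /=.
by apply: eq_bigr => j _; rewrite sqrrD exprMn a1; ring.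
Qed.

Let E_ge u : - N u <= E u.
Proof.
have := @sum_sqr_pm 1 u (expr1n _ 2).
set s := (X in X = _ -> _) => e; have : 0 <= s; last by lra.
by do 2 (apply: sumr_ge0 => ? _); rewrite mulr_ge0 // sqr_ge0.
Qed.

(* In terms of eigenvalues: a bound [a <= 1 / k] improves to [a <= 1 / (2 k - 1)].
   The bound at [v = u - t z], [z] the gradient of [N - k E] at [u], is enough. *)
Let contraction k u : 1 <= k ->
  (forall v, E v <= \sum_(i in U) Ku v i ^+ 2 / g i) ->
  (forall v, \sum_(i in U) g i * v i = 0 -> k * E v <= N v) ->
  \sum_(i in U) g i * u i = 0 -> (2 * k - 1) * E u <= N u.
Proof.
move=> k1 bochner IH u0.
pose z i := u i - k * (Ku u i / g i).
have sumKu : \sum_(i in U) Ku u i = 0.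
  rewrite /Ku exchange_big /= -[RHS]u0; apply: eq_bigr => j _.
  by rewrite /g mulr_suml; apply: eq_bigr => i _; rewrite K_sym.
have gz i : i \in U -> g i * z i = g i * u i - k * Ku u i.
  by move=> iU; rewrite /z; field; rewrite gt_eqF ?g_gt0.
have z0 : \sum_(i in U) g i * z i = 0.
  rewrite (eq_bigr _ gz) sumrB u0 -mulr_sumr sumKu; ring.
(* Since [E z >= - N z], the bound at [v] yields [N u - k E u >= (2 t - (1 + k) t ^+ 2) N z]; this
   [t] maximises the coefficient, with maximum [t]. *)
pose t := (1 + k)^-1.
pose v i := u i - t * z i.
have v0 : \sum_(i in U) g i * v i = 0.
  rewrite (eq_bigr (fun i => g i * u i - t * (g i * z i))); last first.
    by move=> i _; rewrite /v; ring.
  by rewrite sumrB u0 -mulr_sumr z0; ring.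
have Kv i : Ku v i = Ku u i - t * Ku z i.
  rewrite /Ku mulr_sumr -sumrB; apply: eq_bigr => j _; rewrite /v; ring.
have cross : \sum_(i in U) u i * Ku z i = \sum_(i in U) z i * Ku u i.
  rewrite /Ku; under eq_bigr do rewrite mulr_sumr.
  rewrite exchange_big /=; apply: eq_bigr => j _; rewrite mulr_sumr.
  by apply: eq_bigr => i _; rewrite K_sym; ring.
have Ev : E v = E u - 2 * t * (\sum_(i in U) z i * Ku u i) + t ^+ 2 * E z.
  have -> : E v = \sum_(i in U) (u i * Ku u i - t * (u i * Ku z i)
     - t * (z i * Ku u i) + t ^+ 2 * (z i * Ku z i)).
    by apply: eq_bigr => i _; rewrite Kv /v; ring.
  by rewrite big_split /= 2!sumrB -!mulr_sumr cross /E; ring.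
have Nv : N v = N u - 2 * t * (\sum_(i in U) z i * (g i * u i)) + t ^+ 2 * N z.
  rewrite /N !mulr_sumr -sumrB -big_split /=.
  by apply: eq_bigr => i _; rewrite /v; ring.
have Nz : \sum_(i in U) z i * (g i * u i) - k * (\sum_(i in U) z i * Ku u i)
    = N z.
  rewrite mulr_sumr -sumrB; apply: eq_bigr => i iU.
  by rewrite expr2 [RHS]mulrA gz //; ring.
have Nz2 : N z = N u - 2 * k * E u
    + k ^+ 2 * (\sum_(i in U) Ku u i ^+ 2 / g i).
  rewrite /N /E !mulr_sumr -sumrB -big_split /=.
  by apply: eq_bigr => i iU; rewrite /z; field; rewrite gt_eqF ?g_gt0.
have := IH v v0; have := E_ge z; have := bochner u.
move: Ev Nv Nz Nz2.
set b := \sum_(i in U) _ / _; set c1 := \sum_(i in U) z i * (_ * _).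
set c2 := \sum_(i in U) z i * _.
move=> -> -> Nz Nz2 ab Ez; rewrite -subr_ge0.
have -> : N u - 2 * t * c1 + t ^+ 2 * N z - k * (E u - 2 * t * c2 + t ^+ 2 * E z)
  = N u - k * E u - 2 * t * N z + t ^+ 2 * (N z - k * E z).
  have -> : c1 = N z + k * c2 by lra.
  ring.
have t0 : 0 < t by rewrite invr_gt0; lra.
have tk : t * (1 + k) = 1 by rewrite /t mulVf // gt_eqF //; lra.
have kE : N z - k * E z <= (1 + k) * N z by nra.
move=> h1.
have h2 : t * N z <= N u - k * E u.
  have : t ^+ 2 * (N z - k * E z) <= t ^+ 2 * ((1 + k) * N z).
    by rewrite ler_wpM2l // sqr_ge0.
  have -> : t ^+ 2 * ((1 + k) * N z) = t * N z.
    by transitivity (t * (1 + k) * (t * N z)); [ring | rewrite tk mul1r].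
  lra.
have h3 : N z <= (1 + k) * (N u - k * E u).
  have := ler_wpM2l (_ : 0 <= 1 + k) h2.
  rewrite mulrA [(1 + k) * t]mulrC tk mul1r; apply; lra.
(* The Bochner inequality bounds [N z = N u - 2 k E u + k ^+ 2 b] from below in terms of [N u] and
   [E u] only, which closes [h3]. *)
have h4 : k ^+ 2 * E u <= k ^+ 2 * b by rewrite ler_wpM2l // sqr_ge0.
have : k * ((2 * k - 1) * E u) <= k * N u by nra.
by rewrite ler_pM2l //; lra.
Qed.

(* All off-diagonal entries being positive, [K i j >= g i * g j / W], so the
   Dirichlet form dominates a multiple of the variance. *)
Let gap : exists2 d, 0 < d &
  forall u, \sum_(i in U) g i * u i = 0 -> (1 + d) * E u <= N u.
Proof.
have [U0|[i0 i0U]] := set_0Vmem U.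
  by exists 1 => // u _; rewrite /E /N U0 !big_set0; lra.
pose M := \sum_(i in U) g i.
have M0 : 0 < M.
  rewrite /M (bigD1 i0) //= ltr_pwDl ?g_gt0 //.
  by apply: sumr_ge0 => i /andP[iU _]; rewrite ltW ?g_gt0.
(* The summand 1 makes [W > 0] immediate. On the diagonal [K i i] may be 0, but then the quotient is
   0 and only its sign matters. *)
pose W := 1 + \sum_(i in U) \sum_(j in U) g i * g j / K i j.
have sub_ge0 i : i \in U -> 0 <= \sum_(j in U) g i * g j / K i j.
  move=> iU; apply: sumr_ge0 => j jU.
  by rewrite divr_ge0 // mulr_ge0 // ltW // g_gt0.
have W0 : 0 < W by rewrite ltr_pwDl // sumr_ge0.
have KW i j : i \in U -> j \in U -> i != j -> g i * g j <= W * K i j.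
  move=> iU jU ij; rewrite -ler_pdivrMr ?K_gt0 //.
  rewrite /W (bigD1 i) //= (bigD1 j) //=.
  have h1 : 0 <= \sum_(k in U | k != j) g i * g k / K i k.
    apply: sumr_ge0 => k /andP[kU _].
    by rewrite divr_ge0 // mulr_ge0 // ltW // g_gt0.
  have h2 : 0 <= \sum_(k in U | k != i) \sum_(j in U) g k * g j / K k j.
    by apply: sumr_ge0 => k /andP[kU _]; exact: sub_ge0.
  lra.
exists (M / W) => [|u u0]; first by rewrite divr_gt0.
have e1 : \sum_(i in U) \sum_(j in U) K i j * (u i - u j) ^+ 2 = 2 * (N u - E u).
  rewrite -[- E u]mulN1r -sum_sqr_pm ?sqrrN ?expr1n //.
  by do 2 (apply: eq_bigr => ? _); rewrite mulN1r.
(* The variance identity: the cross terms form the square of the mean of [u], which is 0. *)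
have e2 : \sum_(i in U) \sum_(j in U) g i * g j * (u i - u j) ^+ 2 = 2 * (M * N u).
  have -> : 2 * (M * N u) = M * N u + N u * M
      - 2 * ((\sum_(i in U) g i * u i) * (\sum_(i in U) g i * u i)).
    by rewrite u0; ring.
  rewrite /M /N !big_distrlr /= mulr_sumr -big_split -sumrB /=.
  apply: eq_bigr => i _; rewrite mulr_sumr -big_split -sumrB /=.
  by apply: eq_bigr => j _; ring.
have : 2 * (M * N u) <= W * (2 * (N u - E u)).
  rewrite -e1 -e2 mulr_sumr; apply: ler_sum => i iU; rewrite mulr_sumr.
  apply: ler_sum => j jU; rewrite mulrA.
  have [->|ij] := eqVneq i j; first by rewrite subrr expr0n !mulr0.
  by rewrite ler_wpM2r ?sqr_ge0 ?KW.
have : E u <= N u.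
  suff : 0 <= 2 * (N u - E u) by lra.
  rewrite -e1; do 2 (apply: sumr_ge0 => ? _).
  by rewrite mulr_ge0 // sqr_ge0.
move=> h1 h2.
have h3 : M / W * N u <= N u - E u.
  by rewrite mulrAC ler_pdivrMr //; nra.
have d0 : 0 < M / W by rewrite divr_gt0.
have h4 : 0 <= N u.
  by apply: sumr_ge0 => i iU; rewrite mulr_ge0 ?sqr_ge0 // ltW ?g_gt0.
nra.
Qed.

(** [contraction] doubles [k - 1], so iterating it from the gap [d] gives
    [(1 + 2 ^+ n * d) * E u <= N u] for every [n]. A positive [E u] would contradict this for large
    [n]. *)
Lemma bochner_nonpos u :
  (forall v, \sum_(i in U) v i * (\sum_(j in U) K i j * v j) <=
     \sum_(i in U) (\sum_(j in U) K i j * v j) ^+ 2 / (\sum_(j in U) K i j)) ->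
  \sum_(i in U) (\sum_(j in U) K i j) * u i = 0 ->
  \sum_(i in U) u i * (\sum_(j in U) K i j * u j) <= 0.
Proof.
move=> bochner u0.
have [d d0 hd] := gap.
have hn n v : \sum_(i in U) g i * v i = 0 -> (1 + 2 ^+ n * d) * E v <= N v.
  elim: n v => [|n IH] v v0; first by rewrite expr0 mul1r hd.
  have -> : 1 + 2 ^+ n.+1 * d = 2 * (1 + 2 ^+ n * d) - 1 by rewrite exprS; ring.
  apply: contraction => //.
  by rewrite lerDl mulr_ge0 ?exprn_ge0 // ltW.
rewrite leNgt; apply/negP => Eu; rewrite -/(E u) in Eu.
pose n := Num.bound (N u / (d * E u)).
have := archi_boundP (_ : 0 <= N u / (d * E u)).
have N0 : 0 <= N u.
  by apply: sumr_ge0 => i iU; rewrite mulr_ge0 ?sqr_ge0 // ltW ?g_gt0.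
rewrite divr_ge0 // ?mulr_ge0 ?ltW // => /(_ isT).
rewrite ltr_pdivrMr ?mulr_gt0 // -/n => h1.
have h2 := hn n u u0.
have h3 : n%:R <= 2 ^+ n :> R by rewrite -natrX ler_nat ltnW // ltn_expl.
have : n%:R * (d * E u) <= 2 ^+ n * (d * E u) by rewrite ler_wpM2r // mulr_ge0 ?ltW.
lra.
Qed.

End ReversibleKernel.

(** * Mixed permanents and Alexandrov's inequality *)

(* The permanent of the matrix with rows in [U] and columns [cs] when
   [size cs = #|U|]; otherwise the sum over the injections of [cs] into [U]. *)
Fixpoint mixed_perm {R : pzSemiRingType} {T : finType} (U : {set T})
    (cs : seq (T -> R)) : R :=
  if cs is c :: cs' then \sum_(i in U) c i * mixed_perm (U :\ i)%SET cs'
  else 1.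

Definition posfun {R : numDomainType} {T : finType} (c : T -> R) :=
  [forall i, 0 < c i].

Section MixedPermanent.
Variables (R : realType) (T : finType).
Implicit Types (U : {set T}) (c d x y : T -> R) (cs ds : seq (T -> R)).

Lemma mixed_perm_congr U c cs ds :
  (forall V, mixed_perm V cs = mixed_perm V ds) ->
  mixed_perm U (c :: cs) = mixed_perm U (c :: ds).
Proof. by move=> e /=; apply: eq_bigr => i _; rewrite e. Qed.

Lemma mixed_perm_swap U c d cs :
  mixed_perm U (c :: d :: cs) = mixed_perm U (d :: c :: cs).
Proof.
rewrite /=; under eq_bigr do rewrite mulr_sumr.
under [RHS]eq_bigr do rewrite mulr_sumr.
rewrite (exchange_big_dep (mem U)) /=; last by move=> i j _ /setD1P[].
apply: eq_bigr => i iU; apply: eq_big => [j|j _].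
  by rewrite !inE iU andbT andbC eq_sym.
rewrite mulrCA; congr (_ * (_ * mixed_perm _ _)).
by rewrite finset.setDDl finset.setUC -finset.setDDl.
Qed.

Lemma mixed_perm_cat_cons U cs c ds :
  mixed_perm U (cs ++ c :: ds) = mixed_perm U (c :: cs ++ ds).
Proof.
elim: cs U => // d cs IH U.
by rewrite mixed_perm_swap /= -/(mixed_perm _ _); apply: eq_bigr => i _; rewrite IH.
Qed.

Lemma mixed_permDl U c d cs :
  mixed_perm U ((fun i => c i + d i) :: cs)
  = mixed_perm U (c :: cs) + mixed_perm U (d :: cs).
Proof. by rewrite /= -big_split; apply: eq_bigr => i _; rewrite mulrDl. Qed.

Lemma mixed_permZl U a c cs :
  mixed_perm U ((fun i => a * c i) :: cs) = a * mixed_perm U (c :: cs).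
Proof. by rewrite /= mulr_sumr; apply: eq_bigr => i _; rewrite mulrA. Qed.

Lemma mixed_perm_gt0 U cs :
  (size cs <= #|U|)%N -> all posfun cs -> 0 < mixed_perm U cs.
Proof.
elim: cs U => [|c cs IH] U /=; first by rewrite ltr01.
move=> szU /andP[/forallP c0 cs0].
have szi i : i \in U -> (size cs <= #|U :\ i|%SET)%N.
  by move=> iU; rewrite -ltnS (leq_trans szU) // (cardsD1 i U) iU.
have /card_gt0P[i iU] : (0 < #|U|)%N by apply: leq_trans szU.
rewrite (bigD1 i) //= ltr_pwDl ?mulr_gt0 ?IH ?szi //.
by apply: sumr_ge0 => j /andP[jU _]; rewrite mulr_ge0 // ltW // IH ?szi.
Qed.

Lemma mixed_perm_nseq U n c : #|U| = n ->
  mixed_perm U (nseq n c) = n`!%:R * \prod_(i in U) c i.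
Proof.
elim: n U => [|n IH] U Un /=.
  by rewrite (cards0_eq Un) big_set0 mulr1.
rewrite (eq_bigr (fun i => n`!%:R * \prod_(j in U) c j)) => [|i iU].
  by rewrite sumr_const Un factS natrM -mulrA [RHS]mulr_natl.
have Ui : #|U :\ i|%SET = n by apply: succn_inj; rewrite -Un (cardsD1 i U) iU.
rewrite IH // [in RHS](big_setD1 i) //=; ring.
Qed.

(* If a quadratic form is nonpositive on the polar of one vector [c], then
   Cauchy-Schwarz is reversed at every [x] where it is positive: [p x - s y] is
   the point of the polar of [c] in the plane of [x] and [y], and [a], [b], [d]
   are the entries of the Gram matrix of [x] and [y]. *)
Lemma reverse_CS (a b d p s : R) : 0 < a -> s != 0 ->
  p ^+ 2 * a - 2 * p * s * b + s ^+ 2 * d <= 0 -> a * d <= b ^+ 2.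
Proof.
move=> a0 s0 h.
have s2 : 0 < s ^+ 2 by rewrite exprn_even_gt0.
rewrite -(ler_pM2l s2).
have := ler_wpM2l (ltW a0) h; have := sqr_ge0 (p * a - s * b); nra.
Qed.

(** For two rows the difference is a perfect square. In the induction step [reverse_CS] reduces the
    claim to nonpositivity of the form on the polar of the fixed column [c]. The column [y] may have
    any sign, as the induction applies the inequality to arbitrary vectors. *)
Lemma mixed_perm_alexandrov U cs x y :
  #|U| = (size cs).+2 -> all posfun cs -> posfun x ->
  mixed_perm U (x :: x :: cs) * mixed_perm U (y :: y :: cs)
  <= mixed_perm U (x :: y :: cs) ^+ 2.
Proof.
elim: cs U x y => [|c cs IH] U x y Ucard.
  move=> _ _; have /cards2P[i [j [ij ->]]] : #|U| == 2 by rewrite Ucard.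
  have e (a b : T -> R) :
      mixed_perm [set i; j]%SET [:: a; b] = a i * b j + a j * b i.
    rewrite /= big_setU1 ?inE //= big_set1.
    have -> : ([set i; j] :\ i)%SET = [set j]%SET.
      by apply/setP => z; rewrite !inE; case: eqVneq => // ->; rewrite (negbTE ij).
    have -> : ([set i; j] :\ j)%SET = [set i]%SET.
      apply/setP => z; rewrite !inE; case: (eqVneq z j) => [->|_].
        by rewrite eq_sym (negbTE ij).
      by rewrite orbF.
    by rewrite !big_set1 !mulr1.
  rewrite !e -subr_ge0; have := sqr_ge0 (x i * y j - x j * y i).
  by congr (0 <= _); ring.
move=> /= /andP[cpos cspos] xpos.
have c0 i : 0 < c i by move/forallP: cpos.
have Ui i : i \in U -> #|U :\ i|%SET = (size cs).+2.
  by move=> iU; apply: succn_inj; rewrite -[RHS]Ucard (cardsD1 i U) iU.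
have Uij i j : i \in U -> j \in U -> i != j -> #|U :\ i :\ j|%SET = (size cs).+1.
  move=> iU jU ij; apply: succn_inj; rewrite -(Ui i iU) (cardsD1 j (U :\ i)%SET).
  by rewrite !inE eq_sym ij jU.
pose B u v := mixed_perm U (u :: v :: c :: cs).
(* The weights [c i * c j] encode the substitution [v = c u]: the column [c] becomes the constant
   vector 1, and being polar to [c] becomes having mean zero for the row sums of [K]. *)
pose K i j := c i * c j * (if (j \in U) && (i \in U) && (i != j)
                           then mixed_perm (U :\ i :\ j)%SET (c :: cs) else 0).
pose H i (v : T -> R) := mixed_perm (U :\ i)%SET (v :: c :: cs).
have KE i (v : T -> R) : i \in U ->
    \sum_(j in U) K i j * v j = c i * H i (fun j => c j * v j).
  move=> iU; rewrite /H /= mulr_sumr [RHS]big_mkcond [LHS]big_mkcond.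
  apply: eq_bigr => j _; rewrite /K !inE iU andbT (eq_sym i).
  by case: (j \in U); case: eqVneq => //= _; ring.
have K_sym i j : K i j = K j i.
  rewrite /K (mulrC (c i)) (eq_sym i) (andbC (j \in U)); congr (_ * _).
  by case: ifP => // _; rewrite finset.setDDl finset.setUC -finset.setDDl.
have K_gt0 i j : i \in U -> j \in U -> i != j -> 0 < K i j.
  move=> iU jU ij; rewrite /K iU jU ij !mulr_gt0 //.
  by apply: mixed_perm_gt0; rewrite /= ?cpos ?cspos // Uij.
have K_ge0 i j : 0 <= K i j.
  rewrite /K; case: ifP => [/andP[/andP[jU iU] ij]|_]; last by rewrite mulr0.
  rewrite ltW // !mulr_gt0 //.
  by apply: mixed_perm_gt0; rewrite /= ?cpos ?cspos // Uij.
have gE i : i \in U -> \sum_(j in U) K i j = c i * H i c.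
  move=> iU; have := KE i (fun=> 1) iU.
  under eq_bigr do rewrite mulr1.
  move=> ->; congr (_ * _); apply: eq_bigr => j _; by rewrite mulr1.
have H0 i : i \in U -> 0 < H i c.
  by move=> iU; apply: mixed_perm_gt0; rewrite /= ?cpos ?cspos // Ui.
have g_gt0 i : i \in U -> 0 < \sum_(j in U) K i j.
  by move=> iU; rewrite gE // mulr_gt0 ?H0.
have EE v : B (fun j => c j * v j) (fun j => c j * v j) =
    \sum_(i in U) v i * (\sum_(j in U) K i j * v j).
  rewrite [LHS]/=; apply: eq_bigr => i iU; rewrite KE // /H /=; ring.
(* Expanding along the fixed column [c] instead of [w] leaves mixed permanents on [U :\ i] with [w]
   twice, to which the induction hypothesis applies with [c] as the positive vector. *)
have bochner v : \sum_(i in U) v i * (\sum_(j in U) K i j * v j) <=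
    \sum_(i in U) (\sum_(j in U) K i j * v j) ^+ 2 / \sum_(j in U) K i j.
  set w := fun j => c j * v j.
  have -> : \sum_(i in U) v i * (\sum_(j in U) K i j * v j) =
      \sum_(i in U) c i * mixed_perm (U :\ i)%SET (w :: w :: cs).
    rewrite -EE; exact: (mixed_perm_cat_cons U [:: w; w] c cs).
  apply: ler_sum => i iU; rewrite KE // gE // -/w.
  have -> : (c i * H i w) ^+ 2 / (c i * H i c) = c i * (H i w ^+ 2 / H i c).
    by field; rewrite !gt_eqF ?H0.
  rewrite ler_pM2l // ler_pdivlMr ?H0 // mulrC.
  have := IH (U :\ i)%SET c w (Ui i iU) cspos cpos.
  by rewrite [mixed_perm _ (c :: w :: _)]mixed_perm_swap.
have key v : B c v = 0 -> B v v <= 0.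
  pose u i := v i / c i.
  have -> : v = (fun j => c j * u j).
    by apply/funext => j; rewrite /u mulrC divfK // gt_eqF.
  move=> Bcv; rewrite EE; apply: bochner_nonpos => //.
  move: Bcv; rewrite /B mixed_perm_swap /= => Bcv; rewrite -[RHS]Bcv.
  apply: eq_bigr => i iU; rewrite gE // /H /=; ring.
have BC u v : B u v = B v u by exact: mixed_perm_swap.
have BD u v w : B (fun i => u i + v i) w = B u w + B v w by exact: mixed_permDl.
have BZ a u v : B (fun i => a * u i) v = a * B u v by exact: mixed_permZl.
have Bpos u v : posfun u -> posfun v -> 0 < B u v.
  by move=> u0 v0; apply: mixed_perm_gt0; rewrite /= ?u0 ?v0 ?cpos ?Ucard.
change (B x x * B y y <= B x y ^+ 2).
apply: (@reverse_CS _ _ _ (B c y) (B c x)); rewrite ?gt_eqF ?Bpos //.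
pose z i := B c y * x i + (- B c x) * y i.
have Bz w : B z w = B c y * B x w - B c x * B y w by rewrite BD !BZ; ring.
have := key z; rewrite (BC c) Bz (BC x c) (BC y c) mulrC subrr => /(_ erefl).
by rewrite Bz (BC x z) (BC y z) !Bz (BC y x) => h; apply: le_trans h; nra.
Qed.

End MixedPermanent.

(** * Capacity *)

Section Capacity.
#[local] Arguments mixed_perm : simpl never.
Variables (R : realType) (T : finType).
Implicit Types (U : {set T}) (a b v : T -> R) (bs cs : seq (T -> R)).

(* Alexandrov's inequality propagates the ratio [rho] to the columns [a :: cs]. *)
Lemma mixed_perm_nseq_le U d v a t rho cs :
  posfun v -> posfun a -> all posfun cs -> 0 <= t -> 0 <= rho ->
  #|U| = (d + size cs)%N ->
  (forall d', d = d'.+1 -> mixed_perm U (nseq d' v ++ a :: cs)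
                           <= rho * mixed_perm U (nseq d v ++ cs)) ->
  mixed_perm U (nseq d (fun i => v i + t * a i) ++ cs)
  <= mixed_perm U (nseq d v ++ cs) * (1 + t * rho) ^+ d.
Proof.
move=> v0 a0 + t0 r0; elim: d cs => [|d IH] cs cs0 Ud hr.
  by rewrite expr0 mulr1.
have allv n c : all posfun (nseq n v ++ c) = all posfun c.
  by rewrite all_cat all_nseq v0 orbT.
have r1 := hr d erefl.
have Udv : #|U| = (d + size (v :: cs))%N by rewrite Ud addSnnS.
have Uda : #|U| = (d + size (a :: cs))%N by rewrite Ud addSnnS.
(* One copy of [v + t a] is split by linearity and the induction hypothesis is applied with [v] and
   with [a] added to [cs]. The two bounds add up to one more factor [1 + t * rho]. *)
have -> : mixed_perm U (nseq d.+1 (fun i => v i + t * a i) ++ cs)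
  = mixed_perm U (nseq d (fun i => v i + t * a i) ++ v :: cs)
    + t * mixed_perm U (nseq d (fun i => v i + t * a i) ++ a :: cs).
  by rewrite !mixed_perm_cat_cons -mixed_permZl -mixed_permDl.
have hv : mixed_perm U (nseq d (fun i => v i + t * a i) ++ v :: cs)
    <= mixed_perm U (nseq d.+1 v ++ cs) * (1 + t * rho) ^+ d.
  rewrite -[nseq d.+1 v ++ cs]/(v :: nseq d v ++ cs) -mixed_perm_cat_cons.
  apply: IH => // [|d' dd']; first by rewrite /= v0.
  have -> : mixed_perm U (nseq d' v ++ a :: v :: cs)
      = mixed_perm U (nseq d v ++ a :: cs).
    rewrite dd' mixed_perm_cat_cons (mixed_perm_cat_cons U (a :: nseq d' v)).
    by rewrite (mixed_perm_cat_cons U (v :: nseq d' v)) mixed_perm_swap.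
  by rewrite (mixed_perm_cat_cons U _ v).
have ha : mixed_perm U (nseq d (fun i => v i + t * a i) ++ a :: cs)
    <= mixed_perm U (nseq d v ++ a :: cs) * (1 + t * rho) ^+ d.
  apply: IH => // [|d' dd']; first by rewrite /= a0.
  rewrite dd' /= in r1 *.
  have p0 : 0 < mixed_perm U [:: v, v & nseq d' v ++ cs].
    apply: mixed_perm_gt0; rewrite /= ?v0 ?allv //.
    by rewrite size_cat size_nseq Ud dd' !addSn.
  have := @mixed_perm_alexandrov _ _ U (nseq d' v ++ cs) v a.
  rewrite size_cat size_nseq Ud dd' !addSn allv => /(_ erefl cs0 v0).
  move: r1; rewrite -[v :: nseq d' v ++ a :: cs]/((v :: nseq d' v) ++ a :: cs).
  rewrite !mixed_perm_cat_cons /=.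
  rewrite [mixed_perm U (a :: nseq d' v ++ a :: cs)]
    (@mixed_perm_congr _ _ U a _ (a :: nseq d' v ++ cs)); last first.
    by move=> V; rewrite mixed_perm_cat_cons.
  rewrite (mixed_perm_swap U a v) => r1.
  set p1 := mixed_perm U _ in p0 r1 *; set p2 := mixed_perm U [:: a, a & _].
  set p3 := mixed_perm U _ in r1 *.
  have p3_0 : 0 < p3.
    apply: mixed_perm_gt0; rewrite /= ?v0 ?a0 ?allv //.
    by rewrite size_cat size_nseq Ud dd' !addSn.
  move=> h; rewrite -(ler_pM2l p0); apply: (le_trans h).
  have := ler_wpM2r (ltW p3_0) r1; lra.
apply: (le_trans (lerD hv (ler_wpM2l t0 ha))).
have q0 : 0 <= (1 + t * rho) ^+ d by rewrite exprn_ge0 // addr_ge0 // mulr_ge0.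
have := ler_wpM2l t0 (ler_wpM2r q0 r1).
rewrite /= exprS; lra.
Qed.

(** Variables and columns are lists because the capacity induction removes them one at a time. *)
Definition lincomb (xs : seq R) bs : T -> R :=
  fun i => \sum_(p <- zip xs bs) p.1 * p.2 i.

Lemma lincomb_cons x xs b bs :
  lincomb (x :: xs) (b :: bs) = (fun i => lincomb xs bs i + x * b i).
Proof. by apply/funext => i; rewrite /lincomb /= big_cons addrC. Qed.

Lemma posfun_lincomb xs b bs : size xs = (size bs).+1 ->
  all (> 0) xs -> all posfun (b :: bs) -> posfun (lincomb xs (b :: bs)).
Proof.
case: xs => // x xs [szx] /= /andP[x0 xs0] /andP[/forallP b0 bs0].
apply/forallP => i; rewrite lincomb_cons ltr_wpDl ?mulr_gt0 //.
rewrite /lincomb; elim: bs xs szx xs0 bs0 => [|c cs IH] [|y ys] //=.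
  by rewrite big_nil.
move=> [szy] /andP[y0 ys0] /andP[/forallP c0 cs0].
by rewrite big_cons addr_ge0 ?IH // mulr_ge0 // ltW.
Qed.

(* The polynomial [mixed_perm U (nseq k (lincomb xs bs) ++ cs) / k!] in [xs]
   is the derivative of the one for [b :: bs] with respect to the variable of
   [b], evaluated at [0] in that variable; it loses at most a factor [e]. *)
Lemma capacity_step U b bs cs C :
  all posfun (b :: bs) -> all posfun cs -> #|U| = ((size bs).+1 + size cs)%N ->
  (forall xs, size xs = (size bs).+1 -> all (> 0) xs ->
     C * \prod_(x <- xs) x <=
     mixed_perm U (nseq (size bs).+1 (lincomb xs (b :: bs)) ++ cs)
       / (size bs).+1`!%:R) ->
  forall xs, size xs = size bs -> all (> 0) xs ->
     C / expR 1 * \prod_(x <- xs) x <=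
     mixed_perm U (nseq (size bs) (lincomb xs bs) ++ b :: cs) / (size bs)`!%:R.
Proof.
move=> /= /andP[b0 bs0] cs0 Un hC xs szx xs0.
have e1 : 1 <= expR 1 :> R by have := @expR_ge1Dx R 1; lra.
have eP : 0 < expR 1 :> R := expR_gt0 1.
(* When [b] is the last variable, [v] below would be the zero column. Here the claim is the
   hypothesis at 1, weakened by the factor e. *)
case: bs => [|b' bs] in bs0 Un hC szx *.
  case: xs szx xs0 => // _ _; rewrite big_nil /= divr1 mulr1.
  have := hC [:: 1] erefl; rewrite /= ltr01 divr1 big_seq1 mulr1 => /(_ isT).
  have -> : lincomb [:: 1] [:: b] = b.
    by apply/funext => i; rewrite /lincomb /= big_seq1 mul1r.
  have : 0 < mixed_perm U (b :: cs).
    by apply: mixed_perm_gt0; rewrite /= ?b0 ?cs0 // Un.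
  move=> m0 h; rewrite ler_pdivrMr //; apply: (le_trans h).
  by rewrite ler_peMr // ltW.
set k := size (b' :: bs) in Un hC szx *.
have k0 : (0 < k)%N by [].
set v := lincomb xs (b' :: bs).
have v0 : posfun v by apply: posfun_lincomb.
have allv n c : all posfun (nseq n v ++ c) = all posfun c.
  by rewrite all_cat all_nseq v0 orbT.
set P0 := mixed_perm U (nseq k.+1 v ++ cs).
set P1 := mixed_perm U (nseq k v ++ b :: cs).
have P0_0 : 0 < P0.
  by apply: mixed_perm_gt0; rewrite ?allv // size_cat size_nseq Un.
have P1_0 : 0 < P1.
  by apply: mixed_perm_gt0; rewrite ?allv /= ?b0 // size_cat size_nseq Un addSnnS.
(* This [t] makes [t * rho = 1 / (k + 1)], so the factor [(1 + t * rho) ^+ k.+1] is at most e. *)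
pose rho := P1 / P0; pose t := (rho * k.+1%:R)^-1.
have rho0 : 0 < rho by rewrite divr_gt0.
have t0 : 0 < t by rewrite invr_gt0 mulr_gt0 // ltr0n.
have := hC (t :: xs); rewrite /= szx t0 big_cons lincomb_cons => /(_ erefl xs0).
have h2 : mixed_perm U (nseq k.+1 (fun i => v i + t * b i) ++ cs)
    <= P0 * (1 + t * rho) ^+ k.+1.
  apply: mixed_perm_nseq_le => //; rewrite ?ltW // => d' [<-].
  by rewrite -/P0 -/P1 /rho divfK // gt_eqF.
have h3 : (1 + t * rho) ^+ k.+1 <= expR 1.
  have -> : t * rho = k.+1%:R^-1.
    by rewrite /t; field; rewrite addr_eq0 !gt_eqF ?andbT //=; lra.
  have -> : expR 1 = expR (k.+1%:R^-1) ^+ k.+1 :> R.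
    by rewrite -expRM_natl mulfV // pnatr_eq0.
  by rewrite lerXn2r ?nnegrE ?expR_ge1Dx ?expR_ge0 // addr_ge0 // invr_ge0.
set M := mixed_perm U _ in h2 *; rewrite -/M => h1.
have {}h1 : C * (t * \prod_(x <- xs) x) <= P0 * expR 1 / k.+1`!%:R.
  apply: (le_trans h1); rewrite ler_wpM2r ?invr_ge0 //.
  by apply: (le_trans h2); rewrite ler_wpM2l // ltW.
have -> : C / expR 1 * \prod_(x <- xs) x
    = (C * (t * \prod_(x <- xs) x)) * (rho * k.+1%:R / expR 1).
  rewrite /t; move: k.+1%:R (pnatr_eq0 R k.+1) => K1 /= K1_0.
  by field; rewrite K1_0 !gt_eqF.
have -> : P1 / k`!%:R = P0 * expR 1 / k.+1`!%:R * (rho * k.+1%:R / expR 1).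
  rewrite factS natrM /rho.
  have F0 : k`!%:R != 0 :> R by rewrite pnatr_eq0 -lt0n fact_gt0.
  move: k.+1%:R (pnatr_eq0 R k.+1) k`!%:R F0 => K1 /= K1_0 F F0.
  by field; rewrite K1_0 F0 !gt_eqF.
by rewrite ler_wpM2r // divr_ge0 ?(ltW eP) // mulr_ge0 // ltW.
Qed.

(** [bs] holds the columns that still carry a variable, [cs] those already differentiated out. Each
    step moves one column across at the cost of a factor e. *)
Lemma mixed_perm_capacity U bs cs C :
  all posfun bs -> all posfun cs -> #|U| = (size bs + size cs)%N ->
  (forall xs, size xs = size bs -> all (> 0) xs ->
     C * \prod_(x <- xs) x <=
     mixed_perm U (nseq (size bs) (lincomb xs bs) ++ cs) / (size bs)`!%:R) ->
  C / expR 1 ^+ size bs <= mixed_perm U (bs ++ cs).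
Proof.
elim: bs cs C => [|b bs IH] cs C bs0 cs0 Un hC.
  by have := hC [::] erefl isT; rewrite big_nil !divr1 mulr1.
rewrite /= exprS invfM mulrA -mixed_perm_cat_cons.
case/andP: (bs0) => b0 bs0'.
apply: IH => //; first by rewrite /= b0.
  by rewrite Un addSnnS.
exact: capacity_step.
Qed.

(** At the start no variable is removed, and all columns being equal the polynomial is the product
    of the linear forms given by the rows. *)
Lemma capacity_le_mixed_perm U bs C :
  all posfun bs -> #|U| = size bs ->
  (forall xs, size xs = size bs -> all (> 0) xs ->
     C * \prod_(x <- xs) x <= \prod_(i in U) lincomb xs bs i) ->
  C / expR 1 ^+ size bs <= mixed_perm U bs.
Proof.
move=> bs0 Un hC; rewrite -[bs in mixed_perm _ bs]cats0.
apply: mixed_perm_capacity => // [|xs szx xs0]; first by rewrite addn0.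
rewrite cats0 mixed_perm_nseq // [_`!%:R * _]mulrC mulfK ?hC //.
Qed.

End Capacity.

(** * Entropy lower bound for the permanent *)

Section PermanentMixed.
Variables (R : comPzRingType) (D : finType) (A : D -> D -> R).

(** Being the identity off [ys] makes each injection of [ys] into [U] correspond to exactly one
    total function. *)
Definition injects (ys : seq D) (U : {set D}) (f : {ffun D -> D}) :=
  [&& [forall y, (y \notin ys) ==> (f y == y)], uniq (map f ys)
    & all (mem U) (map f ys)].

Lemma mixed_perm_columns (U : {set D}) (ys : seq D) : uniq ys ->
  mixed_perm U [seq A^~ y | y <- ys]
  = \sum_(f : {ffun D -> D} | injects ys U f) \prod_(y <- ys) A (f y) y.
Proof.
elim: ys U => [|y ys IH] U /=.
  move=> _; rewrite (big_pred1 [ffun x => x]) ?big_nil // => f.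
  rewrite /injects /= andbT; apply/forallP/eqP => [f1|-> z]; last by rewrite ffunE /=.
  by apply/ffunP => z; rewrite ffunE; exact/eqP/f1.
move=> /andP[yys uys].
rewrite [RHS](partition_big (fun f : {ffun D -> D} => f y) (mem U)) /=; last first.
  by move=> f /and3P[_ _ /andP[]].
apply: eq_bigr => i iU; rewrite IH // mulr_sumr.
(* The fibre over [f y = i] is matched with the injections of [ys] into [U :\ i] by resetting the
   value at [y] to the default [y]. *)
rewrite [RHS](reindex_onto
  (fun f : {ffun D -> D} => [ffun z => if z == y then i else f z])
  (fun f : {ffun D -> D} => [ffun z => if z == y then y else f z])) /=; last first.
  move=> f /andP[_ /eqP fy]; apply/ffunP => z; rewrite !ffunE.
  by case: eqVneq => // ->.
have mapE (f : {ffun D -> D}) :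
    map [ffun z => if z == y then i else f z] ys = map f ys.
  apply/eq_in_map => z zys; rewrite ffunE; case: eqVneq => // zy.
  by rewrite zy (negbTE yys) in zys.
apply: eq_big => [f|f _].
  rewrite /injects /= mapE ffunE !eqxx iU andbT /=.
  apply/and3P/andP => [[/forallP f1 uf /allP fU]|
    [/and3P[/forallP f1 /andP[ni uf] fU] /eqP e]].
    split; last first.
      apply/eqP/ffunP => z; rewrite !ffunE; case: eqVneq => // ->.
      by have := f1 y; rewrite yys => /eqP.
    apply/and3P; split.
    - apply/forallP => z; rewrite inE negb_or ffunE.
      apply/implyP => /andP[/negbTE -> zys].
      by have := f1 z; rewrite zys.
    - by rewrite uf andbT; apply/negP => /fU; rewrite !inE eqxx.
    - by apply/allP => z /fU; rewrite !inE => /andP[].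
  split => //; last first.
    apply/allP => z zf; have zU : z \in U := allP fU z zf.
    rewrite !inE zU andbT.
    by apply: contraNneq ni => <-.
  apply/forallP => z; apply/implyP => zys.
  have [->|zy] := eqVneq z y; first by rewrite -{1}e !ffunE eqxx.
  by have := f1 z; rewrite inE negb_or zy zys ffunE (negbTE zy).
rewrite big_cons ffunE eqxx; congr (_ * _).
rewrite [LHS]big_seq [RHS]big_seq; apply: eq_bigr => z zys; rewrite ffunE.
by case: eqVneq => // zy; rewrite zy (negbTE yys) in zys.
Qed.

Lemma permanent_mixed_perm :
  permanent A = mixed_perm finset.setT [seq A^~ y | y <- enum D].
Proof.
rewrite mixed_perm_columns ?enum_uniq //.
rewrite (reindex_onto (fun s : {perm D} => pval s)
  (fun f : {ffun D -> D} => insubd (perm_one D) f)) /=; last first.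
  move=> f /and3P[_ uf _]; apply: insubdK.
  by rewrite unfold_in /= /injectiveb /dinjectiveb.
(* The permanent assigns columns to rows and [mixed_perm] rows to columns, hence the inverse. *)
rewrite /permanent (reindex_inj invg_inj) /=.
apply: eq_big => [s|s _].
  rewrite valKd eqxx andbT /injects; apply/esym/and3P; split.
  - by apply/forallP => y; rewrite mem_enum.
  - exact: (valP s).
  - by apply/allP => y; rewrite inE.
rewrite (reindex_inj (@perm_inj _ s)) /= big_enum /=.
by apply: eq_bigr => y _; rewrite permK pvalE.
Qed.

End PermanentMixed.

Section EntropyBound.
Variables (R : realType) (D : finType).

(** Weighted AM-GM, as nonnegativity of the relative entropy of [w] with respect to [b / s], where
    [s] is the sum of [b]. It follows termwise from [ln x <= x - 1] at [x = b i / (w i * s)]. *)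
Lemma expR_entropy_le (I : finType) (b w : I -> R) :
  (forall i, 0 < b i) -> (forall i, 0 <= w i) -> \sum_i w i = 1 ->
  expR (\sum_i w i * (ln (b i) - ln (w i))) <= \sum_i b i.
Proof.
move=> b0 w0 w1.
have s0 : 0 < \sum_i b i.
  have [i _|I0] := pickP (@predT I); last first.
    by move: w1; rewrite big_pred0 // => /esym/eqP; rewrite oner_eq0.
  rewrite (bigD1 i) //= ltr_pwDl ?b0 //.
  by apply: sumr_ge0 => j _; rewrite ltW.
set s := \sum_i b i in s0 *.
rewrite -[leRHS]lnK ?posrE // ler_expR -subr_le0.
have -> : \sum_i w i * (ln (b i) - ln (w i)) - ln s
    = \sum_i w i * (ln (b i) - ln (w i) - ln s).
  rewrite -[ln s in LHS]mul1r -w1 mulr_suml -sumrB.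
  by apply: eq_bigr => i _; ring.
apply: (@le_trans _ _ (\sum_i (b i / s - w i))); last first.
  by rewrite sumrB w1 -mulr_suml divff ?subrr // gt_eqF.
apply: ler_sum => i _; have [wi0|wi0] := eqVneq (w i) 0.
  by rewrite wi0 mul0r subr0 divr_ge0 // ltW.
have wp : 0 < w i by rewrite lt_def wi0 w0.
rewrite -!ln_div ?posrE ?divr_gt0 //.
have := @le_ln1Dx R (b i / w i / s - 1).
rewrite [1 + _]addrC subrK ltrBrDl addrN !divr_gt0 // => /(_ isT).
move=> /(ler_wpM2l (ltW wp)) h; apply: (le_trans h).
by rewrite le_eqVlt; apply/orP; left; apply/eqP; field; rewrite wi0 gt_eqF.
Qed.

Variable Q : D -> D -> R.
Hypothesis Q_ge0 : forall x y, 0 <= Q x y.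
Hypothesis Q_row : forall x, \sum_y Q x y = 1.
Hypothesis Q_col : forall y, \sum_x Q x y = 1.

(** AM-GM is applied in each row; the unit column sums of [Q] collect the terms [ln (z y)] into the
    product of the [z y]. *)
Lemma entropy_capacity (A : D -> D -> R) (z : D -> R) :
  (forall x y, 0 < A x y) -> (forall y, 0 < z y) ->
  expR (\sum_x \sum_y Q x y * (ln (A x y) - ln (Q x y))) * \prod_y z y
  <= \prod_x \sum_y z y * A x y.
Proof.
move=> A0 z0.
have -> : \prod_y z y = expR (\sum_x \sum_y Q x y * ln (z y)).
  rewrite exchange_big expR_sum; apply: eq_bigr => y _.
  by rewrite -mulr_suml Q_col mul1r lnK ?posrE.
rewrite -expRD -big_split /= expR_sum; apply: ler_prod => x _.
rewrite expR_ge0 /= -big_split /=.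
rewrite (eq_bigr (fun y => Q x y * (ln (z y * A x y) - ln (Q x y)))).
  by apply: expR_entropy_le => // y; rewrite mulr_gt0.
by move=> y _; rewrite lnM ?posrE //; ring.
Qed.

Lemma permanent_entropy_pos (A : D -> D -> R) : (forall x y, 0 < A x y) ->
  expR (\sum_x \sum_y Q x y * (ln (A x y) - ln (Q x y)) - #|D|%:R)
  <= permanent A.
Proof.
move=> A0; rewrite permanent_mixed_perm expRB.
have -> : expR #|D|%:R = expR 1 ^+ size [seq A^~ y | y <- enum D] :> R.
  by rewrite size_map -cardE -expRM_natr mul1r.
apply: capacity_le_mixed_perm.
- by apply/allP => c /mapP[y _ ->]; apply/forallP => x.
- by rewrite size_map cardsT cardE.
move=> xs; rewrite size_map => szx xs0.
pose z y := nth 0 xs (index y (enum D)).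
have zE : xs = map z (enum D).
  apply: (@eq_from_nth _ 0) => [|i ix]; first by rewrite size_map.
  have y0 : D by apply: (tnth (enum_tuple D)); rewrite cardE -szx; exact: Ordinal ix.
  rewrite (nth_map y0) -?szx // /z index_uniq -?szx ?enum_uniq //.
have z0 y : 0 < z y.
  by apply: (allP xs0); rewrite zE map_f // mem_enum.
have -> : \prod_(x <- xs) x = \prod_y z y by rewrite [in LHS]zE big_map big_enum.
apply: le_trans (entropy_capacity A0 z0) _.
rewrite le_eqVlt; apply/orP; left; apply/eqP.
apply: eq_big => [x|x _]; first by rewrite inE.
rewrite /lincomb zE zip_map big_map big_enum /=; exact: eq_bigr.
Qed.

(** Zero entries are handled by adding [t > 0] to every entry, which only increases the entropy sum,
    and letting [t] tend to 0 in the permanent, a polynomial in [t]. *)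
Lemma permanent_entropy (A : D -> D -> R) :
  (forall x y, 0 <= A x y) -> (forall x y, 0 < Q x y -> 0 < A x y) ->
  expR (\sum_x \sum_y Q x y * (ln (A x y) - ln (Q x y)) - #|D|%:R)
  <= permanent A.
Proof.
move=> A_ge0 AQ.
pose p : {poly R} := permanent (fun x y => (A x y)%:P + 'X).
have pE t : p.[t] = permanent (fun x y => A x y + t).
  rewrite /p /permanent horner_sum; apply: eq_bigr => s _.
  by rewrite horner_prod; apply: eq_bigr => x _; rewrite !hornerE.
have -> : permanent A = p.[0].
  by rewrite pE; congr permanent; apply/funext => x; apply/funext => y; rewrite addr0.
have cp : p.[t] @[t --> 0^'+] --> p.[0].
  by apply: cvg_at_right_filter; exact: continuous_horner.
apply: (cvgr_to_ge cp); near=> t.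
have t0 : 0 < t by near: t; exact: nbhs_right_gt.
rewrite pE; apply: le_trans (permanent_entropy_pos _); last first.
  by move=> x y; rewrite ltr_wpDl.
rewrite ler_expR lerD2r; apply: ler_sum => x _; apply: ler_sum => y _.
have [q0|q0] := eqVneq (Q x y) 0; first by rewrite q0 !mul0r.
have Axy : 0 < A x y by rewrite AQ // lt_def q0 Q_ge0.
rewrite ler_wpM2l // lerD2r ler_ln ?posrE ?lerDl ?ltW //.
by rewrite ltr_pwDl // ltW.
Unshelve. all: by end_near.
Qed.
End EntropyBound.

(** * Maximization of h *)

Lemma continuous_xlnx (R : realType) : continuous (fun x : R => x * ln x).
Proof.
move=> x; have [x0|x0|->] := ltgtP x 0.
- rewrite /continuous_at (@ln0 _ x) ?ltW // mulr0; apply: cvg_near_cst.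
  by near=> y; rewrite ln0 ?mulr0 // ltW //; near: y; exact: lt_nbhsl.
- by apply: cvgM; [exact: cvg_id|exact: continuous_ln].
rewrite /continuous_at mul0r.
(* For [y > 0] the upper bound is [ln y <= y], and the lower one is [- ln s <= 1 / s] at the square
   root [s] of [y]. For [y <= 0] the default [ln y = 0] applies. *)
apply: (@squeeze_cvgr R _ _ R (fun y => - (2 * Num.sqrt y)) (fun y => y ^+ 2)).
- near=> y; have [y0|y0] := leP y 0.
    by rewrite ln0 // mulr0 sqr_ge0 andbT oppr_le0 mulr_ge0 // sqrtr_ge0.
  apply/andP; split; last first.
    by rewrite expr2 ler_pM2l // ltW // ln_sublinear.
  pose s := Num.sqrt y; have s0 : 0 < s by rewrite sqrtr_gt0.
  have ys : y = s ^+ 2 by rewrite sqr_sqrtr // ltW.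
  have l : - ln s <= s^-1.
    by rewrite -lnV ?posrE // ltW // ln_sublinear // invr_gt0.
  rewrite -/s ys lnXn // -mulr_natr.
  have := ler_wpM2l (sqr_ge0 s) l.
  rewrite expr2 -[_ * s * s^-1]mulrA divff ?gt_eqF // mulr1.
  lra.
- have : - (2 * Num.sqrt y) @[y --> (0 : R)] --> - (2 * Num.sqrt (0 : R)).
    by apply: cvgN; apply: cvgM; [exact: cvg_cst|exact: (@sqrt_continuous R 0)].
  by rewrite sqrtr0 mulr0 oppr0.
- have : y ^+ 2 @[y --> (0 : R)] --> (0 : R) ^+ 2 by exact: exprn_continuous.
  by rewrite expr0n.
Unshelve. all: by end_near.
Qed.

Lemma continuous_sumr (R : realType) (X : topologicalType) (I : Type)
    (s : seq I) (P : pred I) (F : I -> X -> R) :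
  (forall i, P i -> continuous (F i)) ->
  continuous (fun x => \sum_(i <- s | P i) F i x).
Proof. by move=> cF; apply: continuous_big => //; exact: add_continuous. Qed.

Section Objective.
Variables (R : realType) (l k : nat).
Implicit Types (r : 'I_l -> R) (m phi : 'I_k.+1 -> nat) (lev : 'I_l -> nat).
Implicit Types S : 'M[R]_(l, k.+1).

(** The row sums are replaced by the constants [lev i], so that on [Zset] only the first sum varies
    with [S]. *)
Definition h_real r m phi lev S : R :=
  \sum_(i < l) \sum_(j < k.+1) (S i j * ln (r i ^+ m j) - S i j * ln (S i j))
  + \sum_(i < l) (lev i)%:R * ln (lev i)%:R
  + \sum_(j < k.+1) (phi j)%:R * ln (phi j)%:R
  - \sum_(j < k.+1) (phi j)%:R.

(** For nonnegative [r], this singles out the points of [Zset] where [h] is not [-oo]. *)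
Definition finite_support r m S :=
  [forall i, forall j, (r i ^+ m j == 0) ==> (S i j == 0)].

Lemma finite_supportP r m S :
  reflect (forall i j, r i ^+ m j = 0 -> S i j = 0) (finite_support r m S).
Proof.
apply: (iffP forallP) => [H i j /eqP rm|H i].
  by have /forallP/(_ j)/implyP/(_ rm)/eqP := H i.
by apply/forallP => j; apply/implyP => /eqP/H/eqP.
Qed.

Lemma xlogE (x y : R) : 0 <= x -> (0 < x -> 0 < y) -> xlog x y = (x * ln y)%:E.
Proof.
rewrite le_eqVlt => /predU1P[<- _|x0 /(_ x0) y0].
  by rewrite /xlog mul0e mul0r.
by rewrite /xlog lne_EFin.
Qed.

Lemma h_finite r m phi lev S : (forall i, 0 <= r i) -> Zset lev phi S ->
  finite_support r m S -> h r m phi S = (h_real r m phi lev S)%:E.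
Proof.
move=> r0 [S0 Srow Scol] /finite_supportP sup.
have rm0 i j : 0 < S i j -> 0 < r i ^+ m j.
  move=> Sij; rewrite lt_def exprn_ge0 // andbT; apply/eqP => /sup e.
  by rewrite e ltxx in Sij.
have natE (n : nat) : xlog n%:R n%:R = (n%:R * ln n%:R)%:E :> \bar R.
  exact: xlogE.
rewrite /h /h_real EFinB !EFinD -!sumEFin; congr (_ + _ + _ - _)%E.
- apply: eq_bigr => i _; rewrite -sumEFin; apply: eq_bigr => j _.
  rewrite xlogE // => [|Sij]; last by rewrite divr_gt0 // rm0.
  congr EFin; have := S0 i j; rewrite le_eqVlt => /predU1P[<-|Sij].
    by rewrite !mul0r subrr.
  by rewrite ln_div ?posrE ?rm0 // mulrBr.
- by apply: eq_bigr => i _; rewrite Srow natE.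
- by apply: eq_bigr => j _; rewrite natE.
Qed.

Lemma h_infinite r m phi S : (forall i, 0 <= r i) -> (forall i j, 0 <= S i j) ->
  ~~ finite_support r m S -> h r m phi S = -oo%E.
Proof.
move=> r0 S0 /forallPn[i /forallPn[j]]; rewrite negb_imply => /andP[/eqP rm Sij].
have Sp : 0 < S i j by rewrite lt_def Sij S0.
rewrite /h (bigD1 i) //= (bigD1 j) //= /xlog rm mul0r le0_lneNy //.
by rewrite gt0_muleNy ?lte_fin // !addNye.
Qed.

Lemma Zset_product lev phi N : (\sum_i lev i = N)%N -> (\sum_j phi j = N)%N ->
  Zset lev phi (\matrix_(i, j) ((lev i)%:R * (phi j)%:R / N%:R : R)).
Proof.
move=> levN phiN.
have cancelN (n : nat) : (n <= N)%N -> n%:R * N%:R / N%:R = n%:R :> R.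
  case: N {levN phiN} => [|N nN]; first by rewrite leqn0 => /eqP->; rewrite !mul0r.
  by rewrite mulfK // pnatr_eq0.
split => [i j|i|j].
- by rewrite mxE divr_ge0 ?mulr_ge0.
- under eq_bigr do rewrite mxE; rewrite -mulr_suml -mulr_sumr -natr_sum phiN.
  by rewrite cancelN // -levN (bigD1 i) //= leq_addr.
- under eq_bigr do rewrite mxE mulrAC; rewrite -!mulr_suml -natr_sum levN.
  by rewrite mulrC mulrA cancelN // -phiN (bigD1 j) //= leq_addr.
Qed.

(** The points with finite value form a compact set on which [h] is the continuous function
    [h_real]. *)
Lemma h_max_finite r m phi lev : (forall i, 0 <= r i) ->
  (exists2 S, Zset lev phi S & finite_support r m S) ->
  exists S, [/\ Zset lev phi S, finite_support r m S &
    forall S', Zset lev phi S' -> finite_support r m S' ->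
      (h r m phi S' <= h r m phi S)%E].
Proof.
move=> r0 [S1 Z1 f1].
pose X := prod_topology (fun _ : 'I_l * 'I_k.+1 => R).
pose mx (g : X) : 'M[R]_(l, k.+1) := \matrix_(i, j) g (i, j).
pose fn S : X := fun p => S p.1 p.2.
have fnK S : mx (fn S) = S by apply/matrixP => i j; rewrite mxE.
(* Coordinates with [r i ^+ m j = 0] are pinned to 0; the others are bounded by their row sum.
   Tychonoff then gives compactness. *)
pose box : set X := [set g | forall p,
  (if r p.1 ^+ m p.2 == 0 then [set 0 : R] else `[0, (lev p.1)%:R]%classic) (g p)].
have box_compact : compact box.
  apply: (@tychonoff _ (fun _ : 'I_l * 'I_k.+1 => R : topologicalType)
    (fun p => if r p.1 ^+ m p.2 == 0 then [set 0 : R] else _)) => p.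
  by case: ifP => _; [exact: compact_set1|exact: segment_compact].
pose row : set X :=
  \bigcap_(i in [set: 'I_l]) [set g : X | \sum_j g (i, j) = (lev i)%:R].
pose col : set X :=
  \bigcap_(j in [set: 'I_k.+1]) [set g : X | \sum_i g (i, j) = (phi j)%:R].
have cproj p : continuous (fun g : X => g p : R).
  exact: (@proj_continuous _ (fun _ : 'I_l * 'I_k.+1 => R : topologicalType) p).
have row_closed : closed row.
  apply: closed_bigI => i _.
  apply: (@preimage_closed X R (fun g : X => \sum_j g (i, j)) [set x | x = (lev i)%:R]).
    by move=> g _; apply: continuous_sumr => j _; exact: cproj.
  exact: closed_eq.
have col_closed : closed col.
  apply: closed_bigI => j _.
  apply: (@preimage_closed X R (fun g : X => \sum_i g (i, j)) [set x | x = (phi j)%:R]).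
    by move=> g _; apply: continuous_sumr => i _; exact: cproj.
  exact: closed_eq.
have Kmem g : (box `&` row `&` col) g <->
    Zset lev phi (mx g) /\ finite_support r m (mx g).
  split=> [[[bg rg] cg]|[[g0 gr gc] /finite_supportP gs]].
    split; last first.
      apply/finite_supportP => i j rm; have := bg (i, j).
      by rewrite /= rm eqxx mxE.
    split=> [i j|i|j].
    - rewrite mxE; have := bg (i, j); case: ifP => _ /=; first by move=> ->.
      by rewrite in_itv => /andP[].
    - by rewrite -(rg i) //; apply: eq_bigr => j _; rewrite mxE.
    - by rewrite -(cg j) //; apply: eq_bigr => i _; rewrite mxE.
  split; [split|] => [[i j]|i _|j _] /=.
  - case: eqVneq => [/gs|_]; first by rewrite mxE.
    rewrite /= in_itv /=; have := g0 i j; rewrite mxE => -> /=.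
    rewrite -gr (bigD1 j) //= mxE lerDl; exact: sumr_ge0.
  - by rewrite -gr; apply: eq_bigr => j _; rewrite mxE.
  - by rewrite -gc; apply: eq_bigr => i _; rewrite mxE.
pose G (g : X) : R := \sum_(i < l) \sum_(j < k.+1)
  (g (i, j) * ln (r i ^+ m j) - g (i, j) * ln (g (i, j))).
pose c : R := \sum_(i < l) (lev i)%:R * ln (lev i)%:R
  + \sum_(j < k.+1) (phi j)%:R * ln (phi j)%:R - \sum_(j < k.+1) (phi j)%:R.
have h_realE : (fun g => h_real r m phi lev (mx g)) = (fun g => G g + c).
  apply/funext => g; rewrite /h_real /c /G !addrA; do 3 congr (_ + _).
  by apply: eq_bigr => i _; apply: eq_bigr => j _; rewrite mxE.
have cG : continuous G.
  apply: continuous_sumr => i _; apply: continuous_sumr => j _ g.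
  have cp : {for g, continuous (fun g : X => g (i, j) : R)} by exact: cproj.
  apply: (@cvgB R R^o X (nbhs g) _ (fun g : X => g (i, j) * ln (r i ^+ m j))
    (fun g : X => g (i, j) * ln (g (i, j)))).
    exact: (cvgM cp (cvg_cst _)).
  exact: (@continuous_comp X R R (fun g : X => g (i, j)) (fun x : R => x * ln x)
    g cp (@continuous_xlnx R _)).
have := @compact_EVT_max X R (fun g => h_real r m phi lev (mx g)) (box `&` row `&` col).
case=> [| | |g gK gmax].
- by exists (fn S1); apply/Kmem; rewrite fnK.
- by apply: compact_closedI => //; apply: compact_closedI.
- apply: continuous_subspaceT => g; rewrite h_realE.
  exact: (cvgD (cG g) (cvg_cst _)).
have [Zg fg] := (Kmem g).1 (set_mem gK).
exists (mx g); split => // S' Z' f'.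
rewrite !(h_finite (lev := lev)) // lee_fin -(fnK S'); apply: gmax.
by apply/mem_set/Kmem; rewrite fnK.
Qed.

(** If no point has a finite value, [h] is [-oo] on all of [Zset] and any point is a maximiser; the
    product matrix shows that there is one. *)
Lemma h_max r m phi lev N : (forall i, 0 <= r i) ->
  (\sum_i lev i = N)%N -> (\sum_j phi j = N)%N ->
  exists2 S, Zset lev phi S &
    forall S', Zset lev phi S' -> (h r m phi S' <= h r m phi S)%E.
Proof.
move=> r0 levN phiN.
have [ex|nex] := pselect (exists2 S, Zset lev phi S & finite_support r m S).
  have [S [ZS fS maxS]] := h_max_finite r0 ex.
  exists S => // S' Z'; have [f'|f'] := boolP (finite_support r m S').
    exact: maxS.
  by case: (Z') => S'0 _ _; rewrite (h_infinite phi r0 S'0 f') leNye.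
exists (\matrix_(i, j) ((lev i)%:R * (phi j)%:R / N%:R)) => [|S' Z'].
  exact: Zset_product.
rewrite [h _ _ _ S']h_infinite ?leNye //; first by case: Z'.
by apply/negP => f'; apply: nex; exists S'.
Qed.

(** * Comparison of [h] with the permanent *)

Lemma sum_fiber (D I : finType) (c : D -> I) (F : I -> R) :
  \sum_x F (c x) = \sum_i #|[set x | c x == i]%SET|%:R * F i.
Proof.
rewrite (partition_big c predT) //=; apply: eq_bigr => i _.
rewrite (eq_bigr (fun=> F i)) => [|x /eqP-> //].
by rewrite sumr_const mulr_natl cardsE.
Qed.

Lemma h_le_permanent r m phi lev (D : finType) (cr : D -> 'I_l)
    (cc : D -> 'I_k.+1) S :
  (forall i, 0 <= r i) ->
  (forall i, #|[set x | cr x == i]%SET| = lev i) ->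
  (forall j, #|[set y | cc y == j]%SET| = phi j) ->
  Zset lev phi S ->
  (h r m phi S <= lne (permanent (fun x y => r (cr x) ^+ m (cc y)))%:E)%E.
Proof.
move=> r0 crE ccE ZS; case: (ZS) => S0 Srow Scol.
have [fS|nS] := boolP (finite_support r m S); last by rewrite h_infinite ?leNye.
rewrite (h_finite r0 ZS fS); move/finite_supportP: fS => fS.
pose q i j := S i j / ((lev i)%:R * (phi j)%:R).
have lev0 x : (0 < (lev (cr x))%:R :> R).
  by rewrite ltr0n -crE; apply/card_gt0P; exists x; rewrite inE.
have phi0 y : (0 < (phi (cc y))%:R :> R).
  by rewrite ltr0n -ccE; apply/card_gt0P; exists y; rewrite inE.
have Slev i j : S i j <= (lev i)%:R.
  by rewrite -Srow (bigD1 j) //= lerDl sumr_ge0.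
have Sphi i j : S i j <= (phi j)%:R.
  by rewrite -Scol (bigD1 i) //= lerDl sumr_ge0.
have q_ge0 i j : 0 <= q i j by rewrite divr_ge0 ?mulr_ge0.
have bound : expR (\sum_x \sum_y q (cr x) (cc y) *
     (ln (r (cr x) ^+ m (cc y)) - ln (q (cr x) (cc y))) - #|D|%:R)
   <= permanent (fun x y => r (cr x) ^+ m (cc y)).
  apply: (permanent_entropy (Q := fun x y => q (cr x) (cc y))) => //.
  - move=> x; rewrite (sum_fiber cc (fun j => q (cr x) j)).
    rewrite (eq_bigr (fun j => S (cr x) j / (lev (cr x))%:R)).
      by rewrite -mulr_suml Srow divff // gt_eqF.
    (* The sum over [j] includes empty classes, where [q] divides by 0; there the column sum forces
       [S] to vanish. *)
    move=> j _; rewrite ccE /q; have [pj|pj] := eqVneq ((phi j)%:R : R) 0.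
      have -> : S (cr x) j = 0 by apply/le_anti; rewrite S0 -pj Sphi.
      by rewrite !mul0r mulr0.
    by field; rewrite pj gt_eqF.
  - move=> y; rewrite (sum_fiber cr (fun i => q i (cc y))).
    rewrite (eq_bigr (fun i => S i (cc y) / (phi (cc y))%:R)).
      by rewrite -mulr_suml Scol divff // gt_eqF.
    move=> i _; rewrite crE /q; have [pi|pi] := eqVneq ((lev i)%:R : R) 0.
      have -> : S i (cc y) = 0 by apply/le_anti; rewrite S0 -pi Slev.
      by rewrite !mul0r mulr0.
    by field; rewrite pi gt_eqF.
  - by move=> x y; rewrite exprn_ge0.
  move=> x y qp; rewrite lt_def exprn_ge0 // andbT; apply/eqP => /fS e.
  by move: qp; rewrite /q e mul0r ltxx.
have perm0 := lt_le_trans (expR_gt0 _) bound.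
rewrite lne_EFin // lee_fin -ler_expR lnK ?posrE //; apply: le_trans bound.
rewrite ler_expR le_eqVlt; apply/orP; left; apply/eqP.
rewrite (sum_fiber cr (fun i => \sum_y q i (cc y) *
   (ln (r i ^+ m (cc y)) - ln (q i (cc y))))).
rewrite /h_real; congr (_ - _); last first.
  have -> : #|D| = (\sum_j phi j)%N.
    rewrite -sum1_card (partition_big cc predT) //=; apply: eq_bigr => j _.
    by rewrite -ccE -sum1_card; apply: eq_bigl => y; rewrite inE.
  by rewrite natr_sum.
(* Both marginal terms are spread over the entries of [S], so that the identity can be checked entry
   by entry. *)
have -> : \sum_(i < l) (lev i)%:R * ln (lev i)%:R
    = \sum_(i < l) \sum_(j < k.+1) S i j * ln (lev i)%:R.
  by apply: eq_bigr => i _; rewrite -mulr_suml Srow.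
have -> : \sum_(j < k.+1) (phi j)%:R * ln (phi j)%:R
    = \sum_(i < l) \sum_(j < k.+1) S i j * ln (phi j)%:R.
  by rewrite exchange_big; apply: eq_bigr => j _; rewrite -mulr_suml Scol.
rewrite -!big_split; apply: eq_bigr => i _ /=.
rewrite (sum_fiber cc (fun j => q i j * (ln (r i ^+ m j) - ln (q i j)))).
rewrite crE mulr_sumr -!big_split; apply: eq_bigr => j _ /=; rewrite ccE.
have [Sij|Sij] := eqVneq (S i j) 0; first by rewrite /q Sij !mul0r !mulr0; ring.
have Sp : 0 < S i j by rewrite lt_def Sij S0.
have lp : 0 < (lev i)%:R :> R by exact: lt_le_trans Sp (Slev i j).
have pp : 0 < (phi j)%:R :> R by exact: lt_le_trans Sp (Sphi i j).
have -> : ln (q i j) = ln (S i j) - (ln (lev i)%:R + ln (phi j)%:R).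
  by rewrite /q ln_div ?lnM ?posrE ?mulr_gt0.
(* The size of the block cancels the denominator of [q]. *)
have -> a : (lev i)%:R * ((phi j)%:R * (q i j * a)) = S i j * a.
  by rewrite /q; field; rewrite !gt_eqF.
ring.
Qed.

End Objective.

(** * Classes of the frequency vector and the final bound *)

Lemma freqs_inj k (m : 'I_k -> nat) : injective m -> (forall j, (0 < m j)%N) ->
  injective (freqs m).
Proof.
move=> m_inj m0 i j; rewrite /freqs /with0.
case: unliftP => [i' ->|->]; case: unliftP => [j' ->|->] //.
- by move/m_inj ->.
- by move=> e; have := m0 i'; rewrite e.
- by move=> e; have := m0 j'; rewrite -e.
Qed.

Lemma sum_mults N k (phi : 'I_k -> nat) : (\sum_j phi j <= N)%N ->
  (\sum_j mults N phi j = N)%N.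
Proof.
move=> phiN; rewrite big_ord_recl -[RHS](subnK phiN).
rewrite {1}/mults /with0 unlift_none; congr addn; apply: eq_bigr => j _.
by rewrite /mults /with0 liftK.
Qed.

(** Double counting: by injectivity each point lies in at most one class, so a point in none would
    make the total smaller than [#|D|]. *)
Lemma injective_values_cover (D J : finType) (f : D -> nat) (a : J -> nat) :
  injective a -> (\sum_j #|[set y | f y == a j]%SET| = #|D|)%N ->
  forall y, exists j, f y = a j.
Proof.
move=> a_inj cardD y; apply: contrapT => ny.
have /negP[] := ltnn #|D|; rewrite -{1}cardD.
have -> : (\sum_j #|[set z | f z == a j]%SET| = \sum_z \sum_j (f z == a j))%N.
  rewrite exchange_big; apply: eq_bigr => j _.
  by rewrite -sum1dep_card big_mkcond; apply: eq_bigr => z _; case: ifP.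
rewrite -sum1_card (bigD1 y) //= [X in (_ < X)%N](bigD1 y) //=.
rewrite big1 => [|j _]; last first.
  by apply/eqP; rewrite eqb0; apply/eqP => e; apply: ny; exists j.
rewrite add0n add1n ltnS; apply: leq_sum => z _.
have [[j e]|nj] := pselect (exists j, f z = a j); last first.
  rewrite big1 // => j _; apply/eqP; rewrite eqb0; apply/eqP => e.
  by apply: nj; exists j.
rewrite (bigD1 j) //= e eqxx big1 // => j' j'j; apply/eqP; rewrite eqb0.
by apply: contraNneq j'j => /a_inj ->.
Qed.

Theorem theorem6p3 (R : realType) (D : finType)
    (l : nat) (r : 'I_l -> R) (q : D -> R)
    (r_inj : injective r)
    (r_01 : forall i, 0 <= r i <= 1)
    (q_r : forall x, exists i, q x = r i)
    (q_sum : \sum_x q x <= 1)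
    (k : nat) (m phi : 'I_k -> nat)
    (m_inj : injective m)
    (m_gt0 : forall j, (0 < m j)%N)
    (phi_gt0 : forall j, (0 < phi j)%N)
    (phi_sum : (\sum_j phi j <= #|D|)%N)
    (f : D -> nat)
    (f_phi : forall j : 'I_k.+1,
        #|[set y : D | f y == freqs m j]%SET| = mults #|D| phi j) :
  exists2 v : \bar R,
    is_max (h r (freqs m) (mults #|D| phi)
              @` Zset (level r q) (mults #|D| phi)) v
    & (v <= lne (permanent (fun x y : D => q x ^+ f y))%:E)%E.
Proof.
have r0 i : 0 <= r i by case/andP: (r_01 i).
have fm_inj := freqs_inj m_inj m_gt0.
have phiN := sum_mults phi_sum.
have [cr crP] : {cr : D -> 'I_l & forall x, q x = r (cr x)}.
  exact: (@choice _ _ (fun x i => q x = r i)).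
have [cc ccP] : {cc : D -> 'I_k.+1 & forall y, f y = freqs m (cc y)}.
  apply: (@choice _ _ (fun y j => f y = freqs m j)).
  by apply: injective_values_cover => //; rewrite -[RHS]phiN; apply: eq_bigr.
have crE i : #|[set x | cr x == i]%SET| = level r q i.
  by apply: eq_card => x; rewrite !inE crP (inj_eq r_inj).
have ccE j : #|[set y | cc y == j]%SET| = mults #|D| phi j.
  by rewrite -f_phi; apply: eq_card => y; rewrite !inE ccP (inj_eq fm_inj).
have levN : (\sum_i level r q i = #|D|)%N.
  rewrite -sum1_card (partition_big cr predT) //=; apply: eq_bigr => i _.
  by rewrite -crE -sum1_card; apply: eq_bigl => x; rewrite inE.
have [S ZS maxS] := h_max (freqs m) r0 levN phiN.
exists (h r (freqs m) (mults #|D| phi) S).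
  split; first by exists S.
  by move=> _ [S' Z' <-]; exact: maxS.
have -> : (fun x y : D => q x ^+ f y) = (fun x y => r (cr x) ^+ freqs m (cc y)).
  by apply/funext => x; apply/funext => y; rewrite crP ccP.
exact: (h_le_permanent (freqs m) r0 crE ccE ZS).
Qed.
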